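(* Let $\kappa$ be an uncountable cardinal with $2^{<\kappa}=\kappa$, and let $X$ be a nonempty regular Hausdorff topological space of weight at most $\kappa$. If there is a $\kappa^+$-Borel embedding $f\colon {}^{\kappa}2\to X$, then the $\kappa^+$-Borel hierarchy on $X$ does not collapse, i.e. $\operatorname{ord}_{\kappa^+}(X)=\kappa^+$.
   Context: For a topological space $X$ and an ordinal $\gamma>\omega$, define by recursion on ordinals $\alpha\ge 1$: $\gamma\text{-}\boldsymbol{\Sigma}^0_1(X)$ is the family of open sets; for $\alpha>1$, $\gamma\text{-}\boldsymbol{\Sigma}^0_\alpha(X)$ is the family of all unions $\bigcup_{\xi<\delta}A_\xi$ with $\delta<\gamma$ and each $A_\xi\in\bigcup_{1\le\beta<\alpha}\gamma\text{-}\boldsymbol{\Pi}^0_\beta(X)$; and $\gamma\text{-}\boldsymbol{\Pi}^0_\alpha(X)$ is the family of complements of sets in $\gamma\text{-}\boldsymbol{\Sigma}^0_\alpha(X)$. $\gamma\text{-}\mathbf{Bor}(X)$ is the smallest family of subsets of $X$ containing the open sets and closed under complements and well-ordered unions of length less than $\gamma$. The order is $\operatorname{ord}_\gamma(X)=\min\{\alpha\in\mathrm{Ord}\mid \gamma\text{-}\boldsymbol{\Sigma}^0_\alpha(X)=\gamma\text{-}\mathbf{Bor}(X)\}$. One always has $\operatorname{ord}_{\kappa^+}(X)\le\kappa^+$; the $\kappa^+$-Borel hierarchy on $X$ collapses if $\operatorname{ord}_{\kappa^+}(X)<\kappa^+$. The generalized Cantor space ${}^{\kappa}2$ carries the bounded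 topology, generated by the sets $[s]=\{x\in{}^{\kappa}2\mid s\subseteq x\}$ for $s\in{}^{<\kappa}2$. A function $f\colon Y\to Z$ is $\kappa^+$-Borel if preimages of open sets are $\kappa^+$-Borel. A $\kappa^+$-Borel embedding is an injective function $f\colon Y\to Z$ such that both $f\colon Y\to f[Y]$ and its inverse $f^{-1}\colon f[Y]\to Y$ are $\kappa^+$-Borel, where $f[Y]$ has the subspace topology. *)

(* Defs.v *)
(* Written in MathComp and MathComp-Analysis. *)
From HB Require Import structures.
From mathcomp Require Import all_boot all_classical topology wochoice.

Set Implicit Arguments.
Unset Strict Implicit.
Unset Printing Implicit Defensive.

Local Open Scope classical_set_scope.
Local Open Scope card_scope.

Declare Scope wo_scope.
Delimit Scope wo_scope with wo.

(* An ordinal is represented by a well-ordered type, equality of ordinals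
   being order isomorphism [=o]. *)
Record wotype := WOType {
  wsort :> choiceType;
  wle : rel wsort;
  wleP : well_order wle
}.

Definition wlt (a : wotype) : rel a := fun x y => ~~ wle y x.

Definition iseg (a : wotype) (x : a) : set a := [set y | wlt y x].

Definition order_embedding (a b : wotype) (f : a -> b) :=
  forall x y, wle (f x) (f y) = wle x y.

Definition wo_eq (a b : wotype) :=
  exists f : a -> b, order_embedding f /\ bijective f.
Definition wo_lt (a b : wotype) :=
  exists (f : a -> b) (y : b), order_embedding f /\ range f = iseg y.
Definition wo_le (a b : wotype) := wo_lt a b \/ wo_eq a b.

Notation "a =o b" := (wo_eq a b) (at level 70) : wo_scope.
Notation "a <o b" := (wo_lt a b) (at level 70) : wo_scope.
Notation "a <=o b" := (wo_le a b) (at level 70) : wo_scope.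
Local Open Scope wo_scope.

Lemma unit_wleP : well_order (fun _ _ : unit => true).
Proof. by move=> A [[] A0]; exists tt; split=> // -[]. Qed.

Definition one_wo : wotype := WOType unit_wleP.

(* A cardinal is an initial ordinal. *)
Definition is_cardinal (k : wotype) :=
  forall a : wotype, a <o k -> [set: a] #!= [set: k].

Definition is_succ_cardinal (k l : wotype) :=
  [/\ is_cardinal l, k <o l &
      forall m : wotype, is_cardinal m -> k <o m -> l <=o m].

(* ^{<k}2: binary sequences whose length is an element of [k]; an ordinal
   smaller than [k] is identified with a proper initial segment of [k]. *)
Definition binseq (k : wotype) : Type := {x : k & iseg x -> bool}.

Definition gcantor (k : wotype) : Type := k -> bool.

HB.instance Definition _ (k : wotype) := Choice.on (gcantor k).

Definition cone (k : wotype) (s : binseq k) : set (gcantor k) :=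
  [set x | forall i : iseg (projT1 s), x (val i) = projT2 s i].

(* The bounded topology. The indexing type [I] of the factory has to be pointed,
   so the family of cones is indexed by itself. *)
HB.instance Definition _ (k : wotype) :=
  @isSubBaseTopological.Build (gcantor k) (set (gcantor k)) (range (@cone k)) id.

Section GBorel.
Variables (g : wotype) (X : topologicalType).

(* The recursion on [a] is expressed as an inductive predicate, where
   [gSigma (b i) (~` A i)] means that [A i] is in [gPi (b i)]; the recursive
   equations are [gSigma1] and [gSigma_gt1]. *)
Inductive gSigma : wotype -> set X -> Prop :=
| gSigma_open (a : wotype) (U : set X) : a =o one_wo -> open U -> gSigma a U
| gSigma_bigcup (a d : wotype) (b : d -> wotype) (A : d -> set X) :
    one_wo <o a -> d <o g ->
    (forall i, one_wo <=o b i) -> (forall i, b i <o a) ->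
    (forall i, gSigma (b i) (~` A i)) ->
    gSigma a (\bigcup_i A i).

Definition gPi (a : wotype) : set (set X) := [set ~` A | A in gSigma a].

Definition gBor_closed (F : set (set X)) :=
  (forall A, F A -> F (~` A)) /\
  (forall d : wotype, d <o g -> forall A : d -> set X,
     (forall i, F (A i)) -> F (\bigcup_i A i)).

Definition gBor : set (set X) := smallest gBor_closed open.

(* ord_g(X) = a *)
Definition gBorel_order (a : wotype) :=
  [/\ one_wo <=o a, gSigma a = gBor &
      forall b : wotype, one_wo <=o b -> gSigma b = gBor -> a <=o b].

Let one_wo_irr (a : wotype) : a =o one_wo -> ~ (one_wo <o a).
Proof.
move=> [f [fe [h fh hf]]] [e [y [ee re]]].
have eqy : e tt = y by apply: (can_inj fh); case: (f _); case: (f _).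
have : range e y by exists tt.
rewrite re /iseg /= /wlt -eqy ee => /negP; apply.
by case: (f y).
Qed.

Lemma gSigma1 (a : wotype) : a =o one_wo -> gSigma a = open.
Proof.
move=> a1; apply/seteqP; split=> U; last exact: gSigma_open.
by move=> aU; case: aU a1 => // a' d b A lt1a _ _ _ _ /one_wo_irr.
Qed.

Lemma gSigma_gt1 (a : wotype) : one_wo <o a ->
  gSigma a = [set B | exists2 d : wotype, d <o g & exists2 A : d -> set X,
    (forall i, exists b : wotype, [/\ one_wo <=o b, b <o a & gPi b (A i)]) &
    B = \bigcup_i A i].
Proof.
move=> lt1a; apply/seteqP; split=> [B|_ [d dg [A Aa ->]]].
  move=> aB; case: aB lt1a => [a' U /one_wo_irr //|a' d b A _ dg b1 ba bA _].
  exists d => //; exists A => // i; exists (b i); split=> //.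
  by exists (~` A i) => //; rewrite setCK.
have /choice[b bP] : forall i, exists b : wotype,
    [/\ one_wo <=o b, b <o a & gSigma b (~` A i)].
  by move=> i; have [b [b1 ba [C bC <-]]] := Aa i; exists b; rewrite setCK.
by apply: (@gSigma_bigcup _ _ b) => // i; have [] := bP i.
Qed.

End GBorel.

Definition gBorel_fun (g : wotype) (Y Z : topologicalType) (f : Y -> Z) :=
  forall U : set Z, open U -> gBor g (f @^-1` U).

(* [range f] is coerced to the subtype [set_type (range f)], which carries the
   subspace topology. *)
Definition corestr (Y Z : Type) (f : Y -> Z) (y : Y) : range f :=
  exist _ (f y) (mem_set (imageT f y)).

Definition gBorel_embedding (g : wotype) (Y Z : topologicalType) (f : Y -> Z) :=
  [/\ injective f, gBorel_fun g (corestr f) &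
      exists finv : range f -> Y,
        [/\ cancel (corestr f) finv, cancel finv (corestr f) &
            gBorel_fun g finv]].

Definition weight_le (X : topologicalType) (k : wotype) :=
  exists2 B : set (set X), basis B & B #<= [set: k].

(* Main.v *)
Require Import Defs.
From mathcomp Require Import all_boot all_classical topology wochoice.

Set Implicit Arguments.
Unset Strict Implicit.
Unset Printing Implicit Defensive.

Local Open Scope classical_set_scope.
Local Open Scope card_scope.
Local Open Scope wo_scope.

(** The level [kplus] of the hierarchy on [X] exhausts the Borel sets, and no
    smaller level does.

    Exhaustion rests on the regularity of [kplus]. A union of at most [k] sets
    from lower levels has all its pieces at levels below a common
    [y < kplus] ([succ_regular]), hence appears at the level of [y]; so the
    level [kplus] is closed under complements. It contains the open sets
    because, in a regular space of weight at most [k], an open set is the union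
    of at most [k] closures of basic open sets ([gSigma_succ_gBor]).

    Minimality is a diagonal argument carried out in the Cantor space itself.
    A family [F] of subsets of [gcantor k] is [parametrized] when its members
    are sections [W c] of one assignment [W], indexed by [c : k -> bool], whose
    diagonal, even after a reindexing [p : k -> k] of the code, is Borel. The set
    of the [y] outside [W y] is then a Borel set that is not in [F]
    ([parametrized_diagonal]). Parametrized families are stable under unions of
    complements, since [k] many codes fit into one code by a pairing function
    ([parametrized_bigcup]). Given an embedding [f], induction on the level [a],
    for [a < kplus], shows that the preimages by [f] of the sets of level [a] are
    parametrized ([parametrized_gSigma]). Working with preimages by [f]
    makes it unnecessary to compare the levels of the two spaces: [f] is only a
    Borel map, and it enters through the preimages of basic open sets, which need
    only be Borel.

    If the level [a] were already all of the Borel sets of [X], then every Borel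
    subset [D] of the Cantor space would be such a preimage: [D] is the preimage
    by [f] of its image, which is Borel in the range of [f], hence is the trace
    of a Borel subset of [X] ([gBor_trace]). This contradicts the diagonal
    argument.

    The ordinal arithmetic needed is developed for well-ordered types: any two
    are comparable ([wo_cmp]), and [k * k] injects into [k]. The latter uses the
    hypothesis on binary sequences, by coding a pair as a sequence
    ([pair_injects_binseq]). *)

(** * Well-ordered types *)

Section WellOrder.
Variable a : wotype.
Implicit Types x y z : a.

Lemma exists_least (P : a -> Prop) : (exists x, P x) ->
  exists z, P z /\ forall x, P x -> wle z x.
Proof.
case=> x Px; have [|z [[Pz lbz] _]] := @wleP a [pred x | `[<P x>]].
  by exists x; apply/asboolP.
exists z; split; first exact: (elimT (asboolP _) Pz).
by move=> y Py; apply: lbz; apply/asboolP.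
Qed.

Lemma wle_total x y : wle x y || wle y x.
Proof.
have [|z [zxy zle]] := @exists_least (fun z => z = x \/ z = y).
  by exists x; left.
have := zle x (or_introl erefl); have := zle y (or_intror erefl).
by case: zxy => -> h1 h2; rewrite ?h1 ?h2 ?orbT.
Qed.

Lemma wle_refl x : wle x x.
Proof. by rewrite -[wle x x]orbb wle_total. Qed.

Lemma wle_anti x y : wle x y -> wle y x -> x = y.
Proof.
move=> xy yx; have [|z [_ uz]] := @wleP a [pred z | (z == x) || (z == y)].
  by exists x; rewrite inE eqxx.
have minw w : w = x \/ w = y -> z = w.
  by move=> wE; apply: uz; split=> [|v]; rewrite inE;
    [|move=> /orP[] /eqP ->]; case: wE => ->; rewrite ?eqxx ?orbT ?wle_refl.
by rewrite -(minw x) ?(minw y); [|right|left].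
Qed.

Lemma wle_trans y x z : wle x y -> wle y z -> wle x z.
Proof.
have [|w [wE lew]] := @exists_least (fun w => [\/ w = x, w = y | w = z]).
  by exists x; constructor.
have xw := lew x (Or31 _ _ erefl); have yw := lew y (Or32 _ _ erefl).
have zw := lew z (Or33 _ _ erefl); move: xw yw zw.
case: wE => -> // wx wy wz xy yz.
  by rewrite (wle_anti xy wx).
by rewrite -(wle_anti yz wy).
Qed.

Lemma wltNge x y : wlt x y = ~~ wle y x. Proof. by []. Qed.

Lemma wltW x y : wlt x y -> wle x y.
Proof. by move=> /negbTE xy; have := wle_total x y; rewrite xy orbF. Qed.

Lemma wlt_irr x : ~~ wlt x x.
Proof. by rewrite negbK wle_refl. Qed.

Lemma wle_lt_trans y x z : wle x y -> wlt y z -> wlt x z.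
Proof. by move=> xy; apply: contra => zx; apply: wle_trans xy. Qed.

Lemma wlt_le_trans y x z : wlt x y -> wle y z -> wlt x z.
Proof. by move=> xy yz; apply: contra xy; apply: wle_trans. Qed.

Lemma wlt_trans y x z : wlt x y -> wlt y z -> wlt x z.
Proof. by move=> /wltW; apply: wle_lt_trans. Qed.

Lemma wlt_cmp x y : [\/ wlt x y, x = y | wlt y x].
Proof.
case xy: (wle x y); last by constructor 3; rewrite wltNge xy.
case yx: (wle y x); last by constructor 1; rewrite wltNge yx.
by constructor 2; apply: wle_anti.
Qed.

Lemma wlt_ind (P : a -> Prop) :
  (forall x, (forall y, wlt y x -> P y) -> P x) -> forall x, P x.
Proof.
move=> IH x; apply: contrapT => nPx.
have [|z [nPz zle]] := @exists_least (fun x => ~ P x); first by exists x.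
by apply: nPz; apply: IH => y yz; apply: contrapT => /zle; apply/negP.
Qed.

End WellOrder.

Section Embeddings.
Variables (a b : wotype) (f : a -> b).
Hypothesis fe : order_embedding f.

Lemma embed_wlt x y : wlt (f x) (f y) = wlt x y.
Proof. by rewrite !wltNge fe. Qed.

Lemma embed_inj : injective f.
Proof. by move=> x y fxy; apply: wle_anti; rewrite -fe fxy wle_refl. Qed.

End Embeddings.

(** At a least [x] with [f x < x], the value [f x] would be a smaller one. *)
Lemma embed_id_le (a : wotype) (f : a -> a) : order_embedding f ->
  forall x, wle x (f x).
Proof.
move=> fe; elim/wlt_ind => x IH; apply: contraT => fx.
by have := IH _ fx; rewrite fe (negbTE fx).
Qed.

Definition seg (a : wotype) (x : a) : choiceType := {y : a | wlt y x}.

Lemma seg_wleP (a : wotype) (x : a) :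
  well_order (fun u v : seg x => wle (val u) (val v)).
Proof.
move=> A [u Au].
have [|z [[v Av <-] vle]] := @exists_least a (fun y => exists2 v, v \in A & val v = y).
  by exists (val u), u.
have lev w : w \in A -> wle (val v) (val w) by move=> Aw; apply: vle; exists w.
exists v; split; first by split.
by move=> w [Aw wle']; apply/val_inj/wle_anti; [apply: lev|apply: wle'].
Qed.

Definition seg_wo (a : wotype) (x : a) : wotype := WOType (@seg_wleP a x).

Definition in_seg (a : wotype) (x y : a) (yx : wlt y x) : seg_wo x :=
  exist (fun y => is_true (wlt y x)) y yx.

Lemma wo_eq_refl (a : wotype) : a =o a.
Proof. by exists id; split=> //; exists id. Qed.

Lemma wo_eq_sym (a b : wotype) : a =o b -> b =o a.
Proof.
move=> [f [fe [g fK gK]]]; exists g; split; last by exists f.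
by move=> x y; rewrite -fe !gK.
Qed.

Lemma wo_eq_trans (a b c : wotype) : a =o b -> b =o c -> a =o c.
Proof.
move=> [f [fe fb]] [g [ge gb]]; exists (g \o f); split; last exact: bij_comp.
by move=> x y; rewrite /= ge fe.
Qed.

Lemma eq_lt_trans (a b c : wotype) : a =o b -> b <o c -> a <o c.
Proof.
move=> [f [fe [h fK hK]]] [g [y [ge gy]]]; exists (g \o f), y; split.
  by move=> u v; rewrite /= ge fe.
rewrite -gy; apply/seteqP; split=> [_ [x _ <-]|_ [x _ <-]]; first by exists (f x).
by exists (h x) => //=; rewrite hK.
Qed.

Lemma seg_lt (a : wotype) (x : a) : seg_wo x <o a.
Proof.
exists (val : seg_wo x -> a), x; split=> //.
apply/seteqP; split=> [_ [[y yx] _ <-] //|y yx].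
by exists (in_seg yx).
Qed.

Lemma lt_seg (a b : wotype) (f : b -> a) x :
  order_embedding f -> range f = iseg x -> b =o seg_wo x.
Proof.
move=> fe fx.
have fP y : wlt (f y) x by rewrite -[is_true _]/(iseg x (f y)) -fx; exists y.
pose g y : seg_wo x := in_seg (fP y).
have /choice[h hP] : forall u : seg_wo x, exists y, f y = val u.
  case=> u ux; have [y _ yu] : range f u by rewrite fx.
  by exists y.
exists g; split; first by move=> u v; apply: fe.
exists h => [y|u]; last exact/val_inj/hP.
by apply: (embed_inj fe); rewrite hP.
Qed.

Lemma wo_lt_eq_seg (a b : wotype) : b <o a -> exists x : a, b =o seg_wo x.
Proof. by move=> [f [x [fe fx]]]; exists x; apply: lt_seg fe fx. Qed.

Lemma seg_wlt (a : wotype) (x y : a) : wlt x y -> seg_wo x <o seg_wo y.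
Proof.
move=> xy; pose f (u : seg_wo x) : seg_wo y :=
  in_seg (wlt_trans (valP u) xy).
exists f, (in_seg xy); split=> //.
apply/seteqP; split=> [_ [u _ <-]|[u uy] ux]; first exact: (valP u).
by exists (in_seg (ux : wlt u x)) => //; apply: val_inj.
Qed.

Lemma wo_lt_trans (a b c : wotype) : a <o b -> b <o c -> a <o c.
Proof.
move=> [f [x [fe fx]]] [g [y [ge gy]]]; exists (g \o f), (g x); split.
  by move=> u v; rewrite /= ge fe.
apply/seteqP; split=> [_ [u _ <-]|z zgx].
  rewrite /iseg /= embed_wlt // -[is_true _]/(iseg x (f u)) -fx.
  by exists u.
have [v _ vz] : range g z.
  rewrite gy; apply: wlt_trans zgx _.
  by rewrite -[is_true _]/(iseg y (g x)) -gy; exists x.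
move: zgx; rewrite -vz /iseg /= embed_wlt // => vx.
have [u _ uv] : range f v by rewrite fx.
by exists u => //=; rewrite uv.
Qed.

Lemma lt_eq_trans (a b c : wotype) : a <o b -> b =o c -> a <o c.
Proof.
move=> [f [x [fe fx]]] [g [ge [h gK hK]]]; exists (g \o f), (g x); split.
  by move=> u v; rewrite /= ge fe.
apply/seteqP; split=> [_ [u _ <-]|z zgx].
  rewrite /iseg /= embed_wlt // -[is_true _]/(iseg x (f u)) -fx.
  by exists u.
have [u _ uz] : range f (h z) by rewrite fx /iseg /= -(embed_wlt ge) hK.
by exists u => //=; rewrite uz hK.
Qed.

Lemma wo_lt_irr (a : wotype) : ~ a <o a.
Proof.
move=> [f [x [fe fx]]]; have : iseg x (f x) by rewrite -fx; exists x.
by apply/negP; rewrite negbK embed_id_le.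
Qed.

Lemma le_lt_absurd (a b : wotype) : a <=o b -> b <o a -> False.
Proof.
case=> [ab ba|ab ba]; apply: (@wo_lt_irr a).
  exact: wo_lt_trans ba.
exact: eq_lt_trans ba.
Qed.

Lemma le_lt_trans (a b c : wotype) : a <=o b -> b <o c -> a <o c.
Proof. by case=> [ab|ab]; [apply: wo_lt_trans|apply: eq_lt_trans]. Qed.

Lemma seg_wle (a : wotype) (x y : a) : wle x y -> seg_wo x <=o seg_wo y.
Proof.
move=> xy; case: (wlt_cmp x y) => [/seg_wlt| -> |/negP//]; first by left.
by right; apply: wo_eq_refl.
Qed.

Lemma lt_seg_below (a b : wotype) (y : a) : b <o seg_wo y ->
  exists2 x, wlt x y & b =o seg_wo x.
Proof.
move=> lby; have [x bx] := wo_lt_eq_seg (wo_lt_trans lby (seg_lt y)).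
exists x => //; apply/negP => /seg_wle yx; apply: (le_lt_absurd yx).
exact: eq_lt_trans (wo_eq_sym bx) lby.
Qed.

(** Two elements are matched when the segments below them are isomorphic. The
    back-and-forth form spares the isomorphisms between segments, their
    restrictions and their uniqueness: matching is shown to be functional,
    injective and monotone by induction on elements. *)
Inductive matched (a b : wotype) : a -> b -> Prop :=
  Matched x y :
    (forall x', wlt x' x -> exists2 y', wlt y' y & matched x' y') ->
    (forall y', wlt y' y -> exists2 x', wlt x' x & matched x' y') ->
  matched x y.

Section Comparison.
Variables a b : wotype.

Lemma matched_forth (x x' : a) (y : b) : matched x y -> wlt x' x ->
  exists2 y', wlt y' y & matched x' y'.
Proof. by case=> u v + _; apply. Qed.

Lemma matched_back (x : a) (y y' : b) : matched x y -> wlt y' y ->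
  exists2 x', wlt x' x & matched x' y'.
Proof. by case=> u v _; apply. Qed.

Lemma matched_fun (x : a) (y y' : b) : matched x y -> matched x y' -> y = y'.
Proof.
elim/wlt_ind: x y y' => x IH.
suff sym (y y' : b) : matched x y -> matched x y' -> ~~ wlt y y'.
  by move=> y y' xy xy'; case: (wlt_cmp y y') => // lt;
     [have := sym _ _ xy xy' | have := sym _ _ xy' xy]; rewrite lt.
move=> xy xy'; apply/negP => yy'.
have [x' x'x x'y] := matched_back xy' yy'.
have [y'' y''y x'y''] := matched_forth xy x'x.
by have := wlt_irr y; rewrite -{1}(IH _ x'x _ _ x'y'' x'y) y''y.
Qed.

Lemma matched_inj (x x' : a) (y : b) : matched x y -> matched x' y -> x = x'.
Proof.
elim/wlt_ind: y x x' => y IH.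
suff sym (x x' : a) : matched x y -> matched x' y -> ~~ wlt x x'.
  by move=> x x' xy xy'; case: (wlt_cmp x x') => // lt;
     [have := sym _ _ xy xy' | have := sym _ _ xy' xy]; rewrite lt.
move=> xy x'y; apply/negP => xx'.
have [y' y'y xy'] := matched_forth x'y xx'.
have [x'' x''x x''y'] := matched_back xy y'y.
by have := wlt_irr x; rewrite -{1}(IH _ y'y _ _ x''y' xy') x''x.
Qed.

Lemma matched_wlt (x x' : a) (y y' : b) :
  matched x y -> matched x' y' -> wlt x x' -> wlt y y'.
Proof.
by move=> xy x'y' /(matched_forth x'y')[y''] + /(matched_fun xy) ->.
Qed.

Lemma matched_wlt_inv (x x' : a) (y y' : b) :
  matched x y -> matched x' y' -> wlt y y' -> wlt x x'.
Proof.
by move=> xy x'y' /(matched_back x'y')[x''] + /(matched_inj xy) ->.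
Qed.

Lemma matched_wle (x x' : a) (y y' : b) :
  matched x y -> matched x' y' -> wle y y' = wle x x'.
Proof.
move=> xy x'y'; apply: negb_inj; apply/idP/idP.
  exact: matched_wlt_inv.
exact: matched_wlt.
Qed.

(** Matching is an isomorphism between an initial segment of [a] and one of
    [b]. They are not both proper, as the least unmatched elements on the two
    sides would match each other. *)
Lemma wo_cmp : [\/ a <o b, a =o b | b <o a].
Proof.
have [tot|] := pselect (forall x : a, exists y : b, matched x y).
  have [f fP] := choice tot.
  have fe : order_embedding f by move=> x x'; apply: matched_wle.
  have [surj|] := pselect (forall y, exists x, f x = y).
    have [g gP] := choice surj.
    constructor 2; exists f; split=> //; exists g => // x.
    by apply: (embed_inj fe); rewrite gP.
  move=> /existsNP/exists_least[y [ny ley]].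
  constructor 1; exists f, y; split=> //; apply/seteqP; split=> [_ [x _ <-]|z zy].
    apply/negP => /= yfx; apply: ny.
    have [lt|->|lt] := wlt_cmp y (f x); last by move/negP: lt.
      have [x' _ x'y] := matched_back (fP x) lt.
      by exists x'; apply: matched_fun (fP x') x'y.
    by exists x.
  have [//|nz] := pselect (range f z).
  suff : wle y z by move/negP: zy.
  by apply: ley => -[x fx]; apply: nz; exists x.
move=> /existsNP/exists_least[x [nx lex]].
have dom x' : wlt x' x -> exists y : b, matched x' y.
  by move=> x'x; apply: contrapT => /lex; apply/negP.
have below x' (y : b) : matched x' y -> wlt x' x.
  move=> x'y; apply/negP => xx'; apply: nx.
  have [lt|->|lt] := wlt_cmp x x'; last by move/negP: lt.
    by have [y' _ xy'] := matched_forth x'y lt; exists y'.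
  by exists y.
have [tot|] := pselect (forall y : b, exists x' : a, matched x' y).
  have [g gP] := choice tot.
  constructor 3; exists g, x; split.
    by move=> y y'; rewrite (matched_wle (gP y) (gP y')).
  apply/seteqP; split=> [_ [y _ <-]|x' x'x]; first exact: below (gP y).
  have [y x'y] := dom _ x'x.
  by exists y => //; apply: matched_inj (gP y) x'y.
move=> /existsNP/exists_least[y [ny ley]].
case: nx; exists y; constructor=> [x' x'x|y' y'y].
  have [y' x'y'] := dom _ x'x; exists y' => //; apply/negP => yy'; apply: ny.
  have [lt|->|lt] := wlt_cmp y y'; last by move/negP: lt.
    by have [x'' _ ?] := matched_back x'y' lt; exists x''.
  by exists x'.
have [x' x'y'] : exists x' : a, matched x' y'.
  by apply: contrapT => /ley; apply/negP.
by exists x' => //; exact: (below _ _ x'y').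
Qed.

Lemma wo_leNgt : a <=o b \/ b <o a.
Proof. by case: wo_cmp => ?; [left; left|left; right|right]. Qed.

End Comparison.

(** * Cardinal arithmetic *)

Definition injects (T U : Type) := exists f : T -> U, injective f.

Lemma injects_trans (T U V : Type) : injects T U -> injects U V -> injects T V.
Proof. by move=> [f fi] [g gi]; exists (g \o f); apply: inj_comp. Qed.

Lemma card_le_set_injects (T U : Type) (A : set T) : A #<= [set: U] -> injects A U.
Proof.
move=> /card_leP[f]; exists (fun x => val (f x)) => x y /val_inj fxy.
by apply: ('inj_f); rewrite ?inE.
Qed.

Lemma card_le_injects (T U : Type) :
  [set: T] #<= [set: U] <-> injects T U.
Proof.
split=> [/card_le_set_injects[f fi]|[f fi]].
  by exists (fun x => f (SigSub (mem_set (I : setT x)))) => x y /fi[].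
have inj : set_inj [set: T] f by move=> x y _ _; apply: fi.
have fTU : set_fun [set: T] [set: U] f by [].
have [g] : $|{injfun [set: T] >-> [set: U]}| by apply/injfunPex; exists f.
exact: inj_card_le g.
Qed.

Lemma wo_lt_injects (a b : wotype) : a <o b -> injects a b.
Proof. by move=> [f [x [fe _]]]; exists f; apply: embed_inj. Qed.

Lemma wo_eq_injects (a b : wotype) : a =o b -> injects a b.
Proof. by move=> [f [fe _]]; exists f; apply: embed_inj. Qed.

Lemma wo_le_injects (a b : wotype) : a <=o b -> injects a b.
Proof. by case=> [/wo_lt_injects|/wo_eq_injects]. Qed.

Section InfiniteCardinal.
Variable k : wotype.
Hypothesis k_card : is_cardinal k.
Hypothesis k_inf : infinite_set [set: k].

(** Hilbert's hotel: shift a sequence of points other than [m] by one place, so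
    that its first point can serve as the image of [m]. *)
Lemma infinite_injects_avoiding (T : choiceType) (m : T) :
  infinite_set [set: T] -> exists2 f : T -> T, injective f & forall x, f x != m.
Proof.
move=> Tinf.
have [u ui] : injects nat {x | x != m}.
  apply/card_le_injects/infiniteP => fin; apply: Tinf.
  have -> : [set: T] = [set m] `|` range (val : {x | x != m} -> T).
    apply/seteqP; split=> // x _; have [->|xm] := eqVneq x m; first by left.
    by right; exists (exist (fun x => is_true (x != m)) x xm).
  by rewrite finite_setU; split; [apply: finite_set1|apply: finite_image].
pose v n := val (u n).
have vi : injective v by move=> i j /val_inj/ui.
have vm n : v n != m := valP (u n).
have /choice[f fP] : forall x, exists y, [\/ x = m /\ y = v 0,
    exists2 n, x = v n & y = v n.+1 | [/\ x <> m, ~ range v x & y = x]].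
  move=> x; have [xm|xm] := pselect (x = m); first by exists (v 0); constructor.
  have [[n _ xn]|nx] := pselect (range v x).
    by exists (v n.+1); constructor 2; exists n.
  by exists x; constructor 3.
exists f => [x y|x]; last first.
  by case: (fP x) => [[_ ->]|[n _ ->]|[/eqP xm _ ->]].
have nv n z : ~ range v z -> v n <> z by move=> + nz; apply; exists n.
case: (fP x) => [[-> ->]|[n -> ->]|[xm nx ->]];
  case: (fP y) => [[-> ->]|[i -> ->]|[ym ny ->]] //; try by move=> /vi.
- by move=> /nv.
- by move=> /vi[->].
- by move=> /nv.
- by move=> /esym/nv.
- by move=> /esym/nv.
Qed.

(** With a maximum, [k] would have the cardinality of the proper segment below
    it, against initiality. *)
Lemma cardinal_no_max (x : k) : exists y, wlt x y.
Proof.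
apply: contrapT => /forallNP xmax.
have /negP[] := k_card (seg_lt x).
apply: Cantor_Bernstein; first by apply/card_le_injects/wo_lt_injects/seg_lt.
have [f fi fx] := infinite_injects_avoiding x k_inf.
have fP y : wlt (f y) x.
  case: (wlt_cmp (f y) x) => // [E|/xmax //].
  by have := fx y; rewrite E eqxx.
apply/card_le_injects; exists (fun y => in_seg (fP y)) => y z.
by move=> /(congr1 val)/fi.
Qed.

(** The support forgets the length, so that equations between binary sequences
    of dependent types turn into equations between subsets of [k]. *)
Definition binseq_support (s : binseq k) : set k :=
  [set z | exists2 i : iseg (projT1 s), val i = z & projT2 s i].

Definition indicator (x : k) (P : k -> bool) : binseq k :=
  existT (fun x : k => iseg x -> bool) x (fun i => P (val i)).

Lemma indicator_support (x : k) (P : k -> bool) : (forall z, P z -> wlt z x) ->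
  binseq_support (indicator x P) = [set z | P z].
Proof.
move=> Px; apply/seteqP; split=> [_ [i <-] //|z Pz].
by exists (SigSub (mem_set (Px _ Pz : iseg x z))).
Qed.

(** A pair is coded by the indicator of the set of its components, which forgets
    their order; the order is recovered from the length of the sequence, one of
    two fixed bounds above the larger component. *)
Lemma pair_injects_binseq : injects (k * k) (binseq k).
Proof.
have [s sP] := choice cardinal_no_max.
pose M (x y : k) := if wle x y then y else x.
pose len (x y : k) := if wle x y then s (M x y) else s (s (M x y)).
have Mx x y : wle x (M x y).
  by rewrite /M; case: ifP => // _; apply: wle_refl.
have My x y : wle y (M x y).
  rewrite /M; case: ifP => xy; first exact: wle_refl.
  by have := wle_total x y; rewrite xy.
have MC x y : M x y = M y x.
  rewrite /M; case: ifP => xy; case: ifP => yx //; first exact: wle_anti.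
  by have := wle_total x y; rewrite xy yx.
have lenM x y : wlt (M x y) (len x y).
  by rewrite /len; case: ifP => // _; apply: wlt_trans (sP _).
pose P (x y z : k) := (z == x) || (z == y).
have PM x y z : P x y z -> wlt z (len x y).
  by move=> /orP[] /eqP ->; apply: wle_lt_trans (lenM _ _).
exists (fun p => indicator (len p.1 p.2) (P p.1 p.2)) => -[x y] [x' y'] /= E.
have lenE : len x y = len x' y' := congr1 (@projT1 _ _) E.
have supE z : P x y z = P x' y' z.
  have := congr1 binseq_support E.
  rewrite !indicator_support; try exact: PM.
  by move=> /seteqP[/(_ z) h1 /(_ z) h2]; apply/idP/idP.
have lenNC u v : u <> v -> len u v <> len v u.
  move=> uv; rewrite /len (MC v u).
  have lts z : s z <> s (s z).
    by move=> sz; have := wlt_irr (s z); rewrite {2}sz sP.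
  case: ifP => h1; case: ifP => h2.
  - by case: uv; apply: wle_anti.
  - exact: lts.
  - by move/esym; apply: lts.
  - by have := wle_total u v; rewrite h1 h2.
have : P x' y' x by rewrite -supE /P eqxx.
have : P x' y' y by rewrite -supE /P eqxx orbT.
have : P x y x' by rewrite supE /P eqxx.
have : P x y y' by rewrite supE /P eqxx orbT.
rewrite /P => y'E x'E yE xE; have [xx'|xx'] := eqVneq x x'.
  rewrite -xx' in yE *.
  by case/orP: y'E => /eqP y'E; case/orP: yE => /eqP yE; congruence.
move: xE x'E; rewrite [x' == x]eq_sym (negbTE xx') /= => /eqP xE /eqP x'E.
case: (lenNC x y); last by rewrite lenE -xE x'E.
by move=> xy; rewrite x'E xy eqxx in xx'.
Qed.

End InfiniteCardinal.

Section SuccessorCardinal.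
Variables k kplus : wotype.
Hypothesis kplus_succ : is_succ_cardinal k kplus.
Hypothesis pairing : injects (k * k) k.

(** A least segment of [kplus] that does not inject into [k] would be a
    cardinal above [k] and smaller than [kplus]. *)
Lemma lt_succ_injects (d : wotype) : d <o kplus -> injects d k.
Proof.
case: kplus_succ => _ _ kplus_min.
suff segk (y : kplus) : injects (seg_wo y) k.
  by move=> /wo_lt_eq_seg[y /wo_eq_injects dy]; apply: injects_trans dy (segk y).
apply: contrapT => ny.
have [|z [nz zle]] := @exists_least kplus (fun y => ~ injects (seg_wo y) k).
  by exists y.
apply: (@le_lt_absurd kplus (seg_wo z)); last exact: seg_lt.
have small (a : wotype) : a <o seg_wo z -> injects a k.
  move=> /lt_seg_below[y' y'z ay'].
  apply: (injects_trans (wo_eq_injects ay')); apply: contrapT => /zle.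
  exact/negP.
apply: kplus_min.
  move=> a /[dup] az /small [f fi]; apply/negP => /card_eqPle[_ za].
  apply: nz; apply: injects_trans (_ : injects _ a) _; last by exists f.
  exact/card_le_injects.
by case: (wo_leNgt (seg_wo z) k) => // /wo_le_injects.
Qed.

Lemma succ_no_injection : ~ injects kplus k.
Proof.
case: kplus_succ => kplus_card kkplus _ /card_le_injects kplusk.
have /negP[] := kplus_card _ kkplus.
by apply: Cantor_Bernstein => //; apply/card_le_injects/wo_lt_injects.
Qed.

Hypothesis k_inf : infinite_set [set: k].

Lemma succ_no_max (y : kplus) : exists z, wlt y z.
Proof.
case: kplus_succ => kplus_card /wo_lt_injects/card_le_injects kkplus _.
apply: cardinal_no_max => //; apply/infiniteP.
by apply: card_le_trans kkplus; apply/infiniteP.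
Qed.

(** If [h] were unbounded, [kplus] would be the union of the segments below its
    values, that is, at most [k] sets each of which injects into [k]; the pairing
    would then inject [kplus] into [k]. *)
Lemma succ_regular (T : Type) (h : T -> kplus) : injects T k ->
  exists y, forall t, wlt (h t) y.
Proof.
move=> [e ei]; apply: contrapT => unb; apply: succ_no_injection.
have [s sP] := choice succ_no_max.
have /choice[t tP] : forall y : kplus, exists t : T, wle y (h t).
  move=> y; apply: contrapT => /forallNP ny; apply: unb; exists y => u; exact/negP/ny.
(* [h (t y)] may equal [y]; its segment is replaced by that of a larger element. *)
have tsP y : wlt y (s (h (t y))) by apply: wle_lt_trans (sP _).
pose g z := projT1 (cid (lt_succ_injects (seg_lt z))).
have gi z : injective (g z) := projT2 (cid (lt_succ_injects (seg_lt z))).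
apply: injects_trans pairing.
exists (fun y => (e (t y), g _ (in_seg (tsP y)))) => y y' [/ei].
move: (tsP y) (tsP y') => + + tE; rewrite tE => yz y'z /gi.
by move=> /(congr1 val).
Qed.

End SuccessorCardinal.

(** * The Borel hierarchy *)

Section BorelSets.
Variables (g : wotype) (X : topologicalType).
Implicit Types A B : set X.

Lemma gSigma_wo_eq (a a' : wotype) A : a =o a' -> gSigma g a A -> gSigma g a' A.
Proof.
move=> + aA; case: aA a' => {a A} [a U a1 oU|a d b A a1 dg b1 ba bA] a' aa'.
  by apply: gSigma_open oU; apply: wo_eq_trans (wo_eq_sym aa') a1.
apply: (gSigma_bigcup _ dg b1 _ bA); first exact: lt_eq_trans aa'.
by move=> i; apply: lt_eq_trans (ba i) aa'.
Qed.

Lemma gBor_open A : open A -> gBor g A.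
Proof. by move=> oA; apply: sub_gen_smallest. Qed.

Lemma gBor_setC A : gBor g A -> gBor g (~` A).
Proof. by move=> gA F /[dup] -[[FC _] _] FF; apply: FC; apply: gA. Qed.

Lemma gBor_wo_bigcup (d : wotype) (A : d -> set X) : d <o g ->
  (forall i, gBor g (A i)) -> gBor g (\bigcup_i A i).
Proof.
by move=> dg gA F /[dup] -[[_ FU] _] FF; apply: FU => // i; apply: gA.
Qed.

Lemma gBor_ind (P : set (set X)) : open `<=` P ->
  (forall A, P A -> P (~` A)) ->
  (forall d : wotype, d <o g -> forall A : d -> set X,
     (forall i, P (A i)) -> P (\bigcup_i A i)) ->
  @gBor g X `<=` P.
Proof. by move=> Po PC PU; apply: smallest_sub. Qed.

Lemma gSigma_sub_gBor (a : wotype) : gSigma g a `<=` @gBor g X.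
Proof.
move=> A; elim=> {a A} [a U _|a d b A _ dg _ _ _ IH]; first exact: gBor_open.
by apply: gBor_wo_bigcup => // i; rewrite -[A i]setCK; apply: gBor_setC.
Qed.

End BorelSets.

Lemma gBor_preimage (g : wotype) (Y Z : topologicalType) (f : Y -> Z) (A : set Z) :
  gBorel_fun g f -> gBor g A -> gBor g (f @^-1` A).
Proof.
move=> fB; apply: (@gBor_ind g Z (fun A => gBor g (f @^-1` A))) => // [B|d dg B gB].
  by rewrite preimage_setC; apply: gBor_setC.
by rewrite preimage_bigcup; apply: gBor_wo_bigcup.
Qed.

Lemma gBor_trace (g : wotype) (X : topologicalType) (S : set X) (A : set S) :
  gBor g A -> exists B : set X, gBor g B /\ A = val @^-1` B.
Proof.
move: A; apply: gBor_ind => [A [B oB <-]|A [B [gB ->]]|d dg A /choice[B AB]].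
- by exists B; split=> //; apply: gBor_open.
- by exists (~` B); split; [apply: gBor_setC|rewrite preimage_setC].
- exists (\bigcup_i B i); split.
    by apply: gBor_wo_bigcup => // i; have [] := AB i.
  by rewrite preimage_bigcup; apply: eq_bigcupr => i _; have [] := AB i.
Qed.

(** Unions in the hierarchy are indexed by well-ordered types below [kplus]; this
    turns a union over any index type of cardinality at most [k] into one over [k],
    filling the unused indices with the empty set. *)
Lemma bigcup_reindex (X T : Type) (k : choiceType) (P : set (set X)) (A : T -> set X) :
  injects T k -> P set0 -> (forall t, P (A t)) ->
  exists C : k -> set X, (forall i, P (C i)) /\ \bigcup_t A t = \bigcup_i C i.
Proof.
move=> [e ei] P0 PA; exists (fun i => \bigcup_(t in [set t | e t = i]) A t); split.
  move=> i; have [[t ti]|nt] := pselect (exists t, e t = i).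
    rewrite (_ : [set t | e t = i] = [set t]) ?bigcup_set1 //.
    by apply/seteqP; split=> [u /= ui|_ ->] //; apply: ei; rewrite ui.
  rewrite (_ : [set t | e t = i] = set0) ?bigcup_set0 //.
  by apply/seteqP; split=> // t ti; apply: nt; exists t.
apply/seteqP; split=> [x [t _ xt]|x [i _ [t _ xt]]]; last by exists t.
by exists (e t) => //; exists t.
Qed.

Section SuccessorHierarchy.
Variables k kplus : wotype.
Hypothesis kplus_succ : is_succ_cardinal k kplus.
Hypothesis pairing : injects (k * k) k.
Hypothesis k_inf : infinite_set [set: k].

Let k_lt : k <o kplus. Proof. by case: kplus_succ. Qed.

Lemma gBor_bigcup (X : topologicalType) (T : Type) (A : T -> set X) :
  injects T k -> (forall t, gBor kplus (A t)) -> gBor kplus (\bigcup_t A t).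
Proof.
move=> Tk gA; have g0 : @gBor kplus X set0 by apply: gBor_open; apply: open0.
have [C [gC ->]] := bigcup_reindex Tk g0 gA.
exact: gBor_wo_bigcup.
Qed.

Lemma infinite_two_points : exists t0 t1 : k, t0 != t1.
Proof.
have [e ei] : injects nat k by apply/card_le_injects/infiniteP.
by exists (e 0), (e 1); apply/eqP => /ei.
Qed.

Lemma gBor_setI (X : topologicalType) (A B : set X) :
  gBor kplus A -> gBor kplus B -> gBor kplus (A `&` B).
Proof.
move=> gA gB.
have -> : A `&` B = ~` \bigcup_(b : bool) ~` (if b then A else B).
  rewrite setC_bigcup; apply/seteqP; split=> [x [Ax Bx] [] _|x h].
  - by rewrite setCK.
  - by rewrite setCK.
  - by split; [have := h true I|have := h false I]; rewrite setCK.
apply: gBor_setC; apply: gBor_bigcup => [|b].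
  have [t0 [t1 /eqP t01]] := infinite_two_points.
  by exists (fun b : bool => if b then t1 else t0) => -[] [] // E; case: t01.
by apply: gBor_setC; case: b.
Qed.

Lemma one_le_cardinal : one_wo <=o k.
Proof.
case: (wo_leNgt one_wo k) => // /wo_lt_injects[e ei].
have [t0 [t1 /eqP[]]] := infinite_two_points.
by apply: ei; case: (e t0); case: (e t1).
Qed.

Lemma one_lt_succ : one_wo <o kplus.
Proof. exact: le_lt_trans one_le_cardinal k_lt. Qed.

Section Collapse.
Variable X : topologicalType.
Hypothesis X_regular : regular_space X.
Hypothesis X_weight : weight_le X k.

Definition low_gPi (A : set X) :=
  exists b : wotype, [/\ one_wo <=o b, b <o kplus & gSigma kplus b (~` A)].

Lemma low_gPi_closed (A : set X) : open (~` A) -> low_gPi A.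
Proof.
move=> oA; exists one_wo; split; [|exact: one_lt_succ|].
  by right; apply: wo_eq_refl.
by apply: gSigma_open => //; apply: wo_eq_refl.
Qed.

Lemma low_gPi0 : low_gPi set0.
Proof. by apply: low_gPi_closed; rewrite setC0; apply: openT. Qed.

Lemma gSigma_succ_bigcup (T : Type) (A : T -> set X) :
  injects T k -> (forall t, low_gPi (A t)) -> gSigma kplus kplus (\bigcup_t A t).
Proof.
move=> Tk lA; have [C [lC ->]] := bigcup_reindex Tk low_gPi0 lA.
have [b bP] := choice lC.
by apply: (@gSigma_bigcup _ _ _ k b) => //; [exact: one_lt_succ|..] => i;
  have [] := bP i.
Qed.

Lemma gSigma_succP (A : set X) : gSigma kplus kplus A ->
  exists C : k -> set X, (forall i, low_gPi (C i)) /\ A = \bigcup_i C i.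
Proof.
rewrite (gSigma_gt1 _ _ one_lt_succ) => -[d dk [C Cb ->]].
apply: bigcup_reindex; [exact: (lt_succ_injects kplus_succ)|exact: low_gPi0|] => i.
by have [b [b1 bk [B bB <-]]] := Cb i; exists b; rewrite setCK.
Qed.

(** By regularity of the space, each point of [U] has a basic neighbourhood whose
    closure is contained in [U]. *)
Lemma gSigma_succ_open (U : set X) : open U -> gSigma kplus kplus U.
Proof.
move=> oU; have [B [oB Bb] Bk] := X_weight.
pose S : set (set X) := [set V | B V /\ closure V `<=` U].
have -> : U = \bigcup_(V : S) closure (val V).
  apply/seteqP; split=> [x Ux|x [[V VS] _]]; last first.
    by have [_] := set_mem VS; apply.
  have [V nV VU] := X_regular (open_nbhs_nbhs (conj oU Ux)).
  have [W [BW Wx] WV] := Bb x _ nV.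
  have SW : S W by split=> //; apply: subset_trans VU; apply: closureS.
  by exists (SigSub (mem_set SW)) => //; apply: subset_closure.
apply: gSigma_succ_bigcup => [|V].
  apply: card_le_set_injects; apply: card_le_trans Bk.
  by apply: subset_card_le => V [].
by apply: low_gPi_closed; apply/closed_openC/closed_closure.
Qed.

(** By regularity of [kplus], the levels of the pieces of a set are bounded
    below [kplus]. So the set already has a smaller level, and its complement
    is a union with a single piece. *)
Lemma gSigma_succ_setC (A : set X) :
  gSigma kplus kplus A -> gSigma kplus kplus (~` A).
Proof.
move=> /gSigma_succP[C [lC ->]].
have [b bP] := choice lC.
have /choice[h hP] : forall i, exists y : kplus, b i =o seg_wo y.
  by move=> i; apply: wo_lt_eq_seg; have [] := bP i.
have [y yP] : exists y, forall t, wlt (h t) y.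
  by apply: (succ_regular kplus_succ pairing) => //; exists id.
(* Unions are only formed at levels above one, so the bound [z] on the levels
   of the pieces is also taken above one. *)
have [u ou] := wo_lt_eq_seg one_lt_succ.
have [z uz yz] : exists2 z, wlt u z & wle y z.
  have [v uv] := succ_no_max kplus_succ k_inf u.
  case yv: (wle y v); first by exists v.
  have vy : wlt v y by rewrite wltNge yv.
  by exists y; [apply: wlt_trans vy|apply: wle_refl].
have zC : gSigma kplus (seg_wo z) (\bigcup_i C i).
  apply: (@gSigma_bigcup _ _ _ k b) => //.
  - exact: eq_lt_trans ou (seg_wlt uz).
  - by move=> i; have [] := bP i.
  - by move=> i; apply: eq_lt_trans (hP i) (seg_wlt (wlt_le_trans (yP i) yz)).
  - by move=> i; have [] := bP i.
have -> : ~` (\bigcup_i C i) = \bigcup_(_ : unit) ~` (\bigcup_i C i).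
  by apply/seteqP; split=> [x nx|x [_ _ //]]; exists tt.
apply: gSigma_succ_bigcup => [|_].
  by have [t0 _] := infinite_two_points; exists (fun=> t0) => -[] [].
exists (seg_wo z); split; [|exact: seg_lt|by rewrite setCK].
by left; apply: eq_lt_trans ou (seg_wlt uz).
Qed.

Lemma gSigma_succ_gBor : gSigma kplus kplus = @gBor kplus X.
Proof.
apply/seteqP; split; first exact: gSigma_sub_gBor.
apply: gBor_ind; [exact: gSigma_succ_open|exact: gSigma_succ_setC|].
move=> d dk A kA.
have [C CP] := choice (fun i => gSigma_succP (kA i)).
have -> : \bigcup_i A i = \bigcup_(p : d * k) C p.1 p.2.
  apply/seteqP; split=> [x [i _]|x [[i j] _ xC]]; last first.
    by exists i => //; have [_ ->] := CP i; exists j.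
  by have [_ ->] := CP i => -[j _ xC]; exists (i, j).
apply: gSigma_succ_bigcup => [|[i j]]; last by have [lC _] := CP i; apply: lC.
have [e ei] := lt_succ_injects kplus_succ dk.
apply: injects_trans pairing; exists (fun p => (e p.1, p.2)).
by move=> [i j] [i' j'] [/ei -> ->].
Qed.

End Collapse.

End SuccessorHierarchy.

(** * Parametrized families and diagonalization *)

Lemma open_cone (k : wotype) (s : binseq k) : open (cone s).
Proof.
exists [set cone s]; last by rewrite bigcup_set1.
by move=> _ ->; apply: (@finI_from1 _ _ _ id); exists s.
Qed.

Lemma open_coordinate (k : wotype) (j : k) : (exists l, wlt j l) ->
  open [set y : gcantor k | y j].
Proof.
move=> [l jl].
have -> : [set y : gcantor k | y j] =
    \bigcup_(s in [set s | cone s `<=` [set y : gcantor k | y j]]) cone s.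
  apply/seteqP; split=> [y yj|y [s sj /sj //]].
  exists (indicator l y) => //= z /(_ (SigSub (mem_set (jl : iseg l j)))) /= ->.
  exact: yj.
by apply: bigcup_open => s _; apply: open_cone.
Qed.

Section Parametrization.
Variables k kplus : wotype.
Hypothesis k_card : is_cardinal k.
Hypothesis kplus_succ : is_succ_cardinal k kplus.
Hypothesis pairing : injects (k * k) k.
Hypothesis k_inf : infinite_set [set: k].

Let Y : topologicalType := gcantor k.

(** [W] plays the part of a universal set. The product of two Cantor spaces is
    avoided: Borel measurability is only required along the maps sending [y]
    to the pair ([y \o p], [y]). The case [p = id] is the diagonal; the other maps are
    those met when a code is decomposed into subcodes. *)
Definition parametrized (F : set (set Y)) :=
  exists W : (k -> bool) -> set Y,
    (forall A, F A -> exists c, A = W c) /\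
    (forall p : k -> k, gBor kplus [set y : Y | W (y \o p) y]).

Lemma parametrized_sub (F G : set (set Y)) :
  F `<=` G -> parametrized G -> parametrized F.
Proof. by move=> FG [W [WG WB]]; exists W; split=> // A /FG/WG. Qed.

Lemma gBor_coordinate (j : k) : gBor kplus [set y : Y | y j].
Proof.
by apply: gBor_open; apply: open_coordinate; apply: cardinal_no_max k_card k_inf j.
Qed.

(** Cantor's argument: the complement of the diagonal of [W] differs from the
    section [W c] at the point [c]. *)
Lemma parametrized_diagonal (F : set (set Y)) : parametrized F ->
  exists2 D, gBor kplus D & ~ F D.
Proof.
move=> [W [WF WB]]; exists (~` [set y : Y | W y y]).
  exact: gBor_setC (WB id).
move=> /WF[c] /seteqP[/(_ c) h1 /(_ c) h2].
have nW : ~ W c c by move=> Wc; apply: (h2 Wc).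
exact: nW (h1 nW).
Qed.

(** A code is the characteristic function of the set of indices used. *)
Lemma parametrized_unions (G : k -> set Y) : (forall i, gBor kplus (G i)) ->
  parametrized [set A | exists D : set k, A = \bigcup_(i in D) G i].
Proof.
move=> GB; exists (fun c => \bigcup_(i in [set i | c i]) G i); split.
  move=> _ [D ->]; exists (fun i => `[<D i>]); congr (bigcup _ _).
  by apply/seteqP; split=> i /asboolP.
move=> p; rewrite (_ : [set _ | _] = \bigcup_i ([set y : Y | y (p i)] `&` G i)).
  apply: (gBor_bigcup kplus_succ) => [|i]; first by exists id.
  by apply: (gBor_setI kplus_succ k_inf) => //; apply: gBor_coordinate.
by apply/seteqP; split=> [y [i yi Gy]|y [i _ [yi Gy]]]; exists i.
Qed.

(** The code of a union contains, for every slot [n] of [k] and every level [i],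
    one bit telling whether the slot is used at this level, stored at
    [flag n i], and a complete code for level [i], stored along [sub n i]. *)
Lemma parametrized_bigcup (I : Type) (F : I -> set (set Y)) : injects I k ->
  (forall i, parametrized (F i)) ->
  parametrized [set B | exists (T : Type) (l : T -> I) (A : T -> set Y),
    [/\ injects T k, forall t, F (l t) (~` A t) & B = \bigcup_t A t]].
Proof.
move=> [e ei] /choice[W WP]; have [P Pi] := pairing.
(* The tags [t0] and [t1] keep the flags and the subcodes apart. *)
have [t0 [t1 t01]] := infinite_two_points k_inf.
pose flag n i := P (t0, P (n, e i)).
pose sub n i j := P (t1, P (P (n, e i), j)).
have flagI n i n' i' : flag n i = flag n' i' -> n = n' /\ i = i'.
  by move=> /Pi[/Pi[-> /ei]].
have subI n i j n' i' j' : sub n i j = sub n' i' j' -> [/\ n = n', i = i' & j = j'].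
  by move=> /Pi[/Pi[/Pi[-> /ei]]].
have flag_sub n i n' i' j' : flag n i <> sub n' i' j'.
  by move=> /Pi[t01' _]; case/eqP: t01.
exists (fun c : k -> bool => \bigcup_(q : k * I)
  ([set y | c (flag q.1 q.2)] `&` ~` W q.2 (c \o sub q.1 q.2))); split.
- move=> _ [T [l [A [[u ui] FA ->]]]].
  have /choice[c cP] : forall t, exists c, ~` A t = W (l t) c.
    by move=> t; have [WF _] := WP (l t); apply: WF.
  pose C m := `[< (exists t, m = flag (u t) (l t)) \/
                  (exists t j, m = sub (u t) (l t) j /\ c t j) >].
  have Csub t : C \o sub (u t) (l t) = c t.
    apply/funext => j; rewrite /= /C; apply/asboolP/idP => [[[t']|[t' [j' []]]]|ctj].
    - by move=> /esym/flag_sub.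
    - by move=> /subI[/ui <- _ <-].
    - by right; exists t, j.
  have Cflag n i : C (flag n i) -> exists t, n = u t /\ i = l t.
    by move=> /asboolP[[t /flagI ?]|[t [j [/flag_sub]]]] //; exists t.
  exists C; apply/seteqP; split=> [y [t _ Ay]|y [[n i] _ /= []]].
    exists (u t, l t) => //=; split; first by apply/asboolP; left; exists t.
    by rewrite Csub -cP; apply.
  by move=> /Cflag[t [-> ->]]; rewrite Csub -cP => /contrapT; exists t.
- move=> p; rewrite (_ : [set _ | _] = \bigcup_(q : k * I)
    ([set y : Y | y (p (flag q.1 q.2))] `&`
     ~` [set y : Y | W q.2 (y \o (p \o sub q.1 q.2)) y])); last first.
    by apply/seteqP; split=> [y [q _ [? ?]]|y [q _ [? ?]]]; exists q.
  apply: (gBor_bigcup kplus_succ) => [|q].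
    by exists (fun q => P (q.1, e q.2)) => -[n i] [n' i'] /Pi[-> /ei ->].
  apply: (gBor_setI kplus_succ k_inf); first exact: gBor_coordinate.
  by apply: gBor_setC; have [_] := WP q.2; apply.
Qed.

Section Preimages.
Variables (X : topologicalType) (f : Y -> X).
Hypothesis f_Borel : forall U, open U -> gBor kplus (f @^-1` U).
Hypothesis X_weight : weight_le X k.

(** Open sets are unions of basic ones, and a basis is indexed by [k]. *)
Lemma parametrized_open : parametrized [set f @^-1` U | U in open].
Proof.
have [B [oB Bb] /card_le_set_injects[e ei]] := X_weight.
have [C [CB BE]] : exists C : k -> set X,
    (forall i, open (C i)) /\ (forall V, B V -> exists i, C i = V).
  have /choice[C CP] : forall i, exists V, (exists2 b : B, e b = i & V = val b)
      \/ (~ (exists b : B, e b = i) /\ V = set0).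
    move=> i; have [[b ei']|] := pselect (exists b : B, e b = i).
      by exists (val b); left; exists b.
    by exists set0; right.
  exists C; split=> [i|V BV].
    case: (CP i) => [[b _ ->]|[_ ->]]; last exact: open0.
    exact/oB/(set_mem (valP b)).
  exists (e (SigSub (mem_set BV))).
  case: (CP (e (SigSub (mem_set BV)))) => [[b /ei -> ->]|[[]]] //.
  by exists (SigSub (mem_set BV)).
apply: parametrized_sub (parametrized_unions (fun i => f_Borel (CB i))).
move=> _ [U oU <-]; exists [set i | C i `<=` U].
apply/seteqP; split=> [y Uy|y [i CU /CU //]].
have [V [BV Vy] VU] := Bb _ _ (open_nbhs_nbhs (conj oU Uy)).
by have [i CV] := BE _ BV; exists i; rewrite /= CV.
Qed.

(** The levels entering a union at level [a] are, up to isomorphism, the segments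
    of [a], and there are at most [k] of them. *)
Lemma parametrized_gSigma (a : wotype) : a <o kplus ->
  parametrized [set f @^-1` B | B in gSigma kplus a].
Proof.
move=> /wo_lt_eq_seg[y]; elim/wlt_ind: y a => y IH a ay.
have [a1|na1] := pselect (a =o one_wo).
  by rewrite (gSigma1 _ _ a1); apply: parametrized_open.
have segk : injects (seg_wo y) k by apply: (lt_succ_injects kplus_succ (seg_lt y)).
apply: parametrized_sub (parametrized_bigcup segk
  (fun x : seg_wo y => IH _ (valP x) _ (wo_eq_refl _))).
move=> _ [B aB <-].
case: aB na1 ay => {a B} [a U a1 _ /(_ a1) //|a d b A _ dk _ ba bA _ ay].
have /choice[l lP] : forall i, exists x : seg_wo y, b i =o seg_wo (val x).
  move=> i; have [x xy bx] := lt_seg_below (lt_eq_trans (ba i) ay).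
  by exists (in_seg xy).
exists d, l, (fun i => f @^-1` A i); split.
- exact: (lt_succ_injects kplus_succ dk).
- move=> i; exists (~` A i); last by rewrite preimage_setC.
  exact: gSigma_wo_eq (lP i) (bA i).
- by rewrite preimage_bigcup.
Qed.

End Preimages.

End Parametrization.

Theorem theorem4p9 (k kplus : wotype) (X : topologicalType)
  (k_card : is_cardinal k)
  (k_uncountable : ~ countable [set: k])
  (k_pow : [set: binseq k] #= [set: k])
  (kplus_succ : is_succ_cardinal k kplus)
  (X_nonempty : [set: X] !=set0)
  (X_regular : regular_space X)
  (X_hausdorff : hausdorff_space X)
  (X_weight : weight_le X k)
  (X_embed : exists f : gcantor k -> X, gBorel_embedding kplus f) :
  gBorel_order kplus X kplus.
Proof.
have k_inf : infinite_set [set: k] by move=> /finite_set_countable.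
have pairing : injects (k * k) k.
  apply: injects_trans (pair_injects_binseq k_card k_inf) _.
  by apply/card_le_injects; move: k_pow => /card_eqPle[].
split.
- by left; apply: one_lt_succ kplus_succ k_inf.
- exact (gSigma_succ_gBor kplus_succ pairing k_inf X_regular X_weight).
move=> b _ bBor; case: (wo_leNgt kplus b) => // b_lt.
have [f [f_inj fB [finv [fK finvK finvB]]]] := X_embed.
have f_Borel U : open U -> gBor kplus (f @^-1` U).
  by move=> oU; apply: (fB (val @^-1` U)); exists U.
have [D gD] := parametrized_diagonal
  (parametrized_gSigma k_card kplus_succ pairing k_inf f_Borel X_weight b_lt).
case; have [B [gB BE]] := gBor_trace (gBor_preimage finvB gD).
exists B; first by rewrite bBor.
transitivity (corestr f @^-1` (finv @^-1` D)); first by rewrite BE.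
by apply/seteqP; split=> y; rewrite /preimage /= fK.
Qed.
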